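(* Consider the real line under the Euclidean topology and let $\alpha$ be an ordinal. Let $y\in\mathbb{N}^{\mathbb{N}}\cap L_\alpha$ code a convergent sequence of reals $\{y_n\}_{n\in\mathbb{N}}\to y_0$, and let $x\in\mathbb{N}^{\mathbb{N}}\cap L_\alpha$ be such that $T=\bigcap_n G_n$, where each $G_n$ is the open set coded by the projection $x_n$ of $x$ and $G_n\in\mathcal{G}_\alpha$. Then there are a $c$-shift $h(u)=u+c$ (with $c\in\mathbb{R}$) and an integer $M$ such that $h(y_0)\in T$ and $$h(y_m)=y_m+c\in T\quad\text{for all } m>M,$$ and $c$ has a code in $L_{\alpha+\omega}$.
   Context: $\langle L_\alpha\rangle$ is Gödel's constructible hierarchy. For $x\in\mathbb{N}^{\mathbb{N}}$, the $n$-th projection $x_n$ is given by $x_n(m)=x(2^n(2m+1))$. Reals are coded by their binary expansions, and a sequence $\{y_n\}$ of reals is coded by $y$ if the $n$-th projection of $y$ codes $y_n$. Let $\{I_n\}_{n\in\mathbb{N}}$ be a fixed effective enumeration of all rational-ended open intervals; an element $a\in\{0,1\}^{\mathbb{N}}$, identified with the subset of $\mathbb{N}$ of which it is the indicator function, codes the open set $G(a):=\bigcup_{n\in a}I_n$. $\mathcal{G}_\alpha$ is the family of open sets $G\subseteq\mathbb{R}$ with $\mathbb{Q}\subseteq G$ that possess a code in $L_\alpha$. *)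

(* Defs.v *)
From mathcomp Require Import all_boot all_order all_algebra.
From mathcomp Require Import all_classical all_reals all_analysis.
Import Order.TTheory GRing.Theory Num.Theory.
Import numFieldNormedType.Exports.

Set Implicit Arguments.
Unset Strict Implicit.
Unset Printing Implicit Defensive.

Local Open Scope classical_set_scope.
Local Open Scope ring_scope.

(* Aczel's well-founded sets: [vsup f] is the set of all [f i].  Equality of
   sets is the extensional equality [veq], not Leibniz equality. *)
Inductive vset : Type := vsup (A : Type) (f : A -> vset).

Definition vdom (x : vset) : Type := let: vsup A _ := x in A.

Definition velt (x : vset) : vdom x -> vset :=
  match x with vsup A f => f end.

Fixpoint veq (x y : vset) {struct x} : Prop :=
  match x, y with
  | vsup A f, vsup B g =>
      (forall i, exists j, veq (f i) (g j)) /\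
      (forall j, exists i, veq (f i) (g j))
  end.

Definition vmem (x y : vset) : Prop := exists j : vdom y, veq x (velt j).

Definition vempty : vset := vsup (fun e : void => match e with end).

Definition vupair (x y : vset) : vset := vsup (fun b : bool => if b then x else y).

(* Kuratowski pairs *)
Definition vpair (x y : vset) : vset := vupair (vupair x x) (vupair x y).

Definition vbigcup (A : Type) (F : A -> vset) : vset :=
  vsup (fun p : {i : A & vdom (F i)} => velt (projT2 p)).

Definition vsucc (x : vset) : vset :=
  vsup (fun o : option (vdom x) => if o is Some i then velt i else x).

Fixpoint vnat (n : nat) : vset :=
  if n is m.+1 then vsucc (vnat m) else vempty.

Definition vomega : vset := vsup vnat.

(* Membership on [vset] is well-founded, so a transitive set that is linearly
   ordered by membership is well-ordered by it. *)
Definition is_ordinal (a : vset) : Prop :=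
  (forall b c, vmem b a -> vmem c b -> vmem c a) /\
  (forall b c, vmem b a -> vmem c a -> vmem b c \/ veq b c \/ vmem c b).

(* a + b = a `|` {a + c | c in b} *)
Fixpoint vadd (a b : vset) {struct b} : vset :=
  let: vsup B g := b in
  vsup (fun s : vdom a + B =>
    match s with inl i => velt i | inr j => vadd a (g j) end).

(* First-order formulas in the language of set theory, with de Bruijn
   variables. *)
Inductive fml : Set :=
| fmem (i j : nat)
| feq (i j : nat)
| fneg (p : fml)
| fand (p q : fml)
| fex (p : fml).

Definition scons (T : Type) (a : T) (e : nat -> T) (i : nat) : T :=
  if i is j.+1 then e j else a.

(* Satisfaction in the structure (X, in), elements of X being represented by
   their indices. *)
Fixpoint sat (X : vset) (p : fml) (e : nat -> vdom X) : Prop :=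
  match p with
  | fmem i j => vmem (velt (e i)) (velt (e j))
  | feq i j => veq (velt (e i)) (velt (e j))
  | fneg q => ~ sat q e
  | fand q r => sat q e /\ sat r e
  | fex q => exists a, sat q (scons a e)
  end.

(* { z in X | (X, in) |= p[z, s_0, ..., s_(k-1)] } for a finite sequence s of
   parameters from X.  Variable 0 is z and variable i+1 is s_i; any further
   free variable is read as z, so that no element of X has to be given and
   Def(set0) = {set0}. *)
Definition vdef (X : vset) (p : fml) (s : seq (vdom X)) : vset :=
  vsup (fun z : {z : vdom X | sat p (scons z (nth z s))} => velt (sval z)).

Definition vDef (X : vset) : vset :=
  vsup (fun q : fml * seq (vdom X) => vdef q.1 q.2).

(* L_a is the union of the Def(L_b), b in a; this is the usual recursion, the
   zero, successor and limit cases being treated uniformly. *)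
Fixpoint Lset (a : vset) : vset :=
  let: vsup A f := a in vbigcup (fun i => vDef (Lset (f i))).

Definition vgraph (x : nat -> nat) : vset :=
  vsup (fun n => vpair (vnat n) (vnat (x n))).

Definition in_L (a : vset) (x : nat -> nat) : Prop := vmem (vgraph x) (Lset a).

Definition nproj (x : nat -> nat) (n m : nat) : nat := x (2 ^ n * (2 * m).+1)%N.

(* z lists the binary expansion of r: the sign z_0, the integer part z_1 of
   `|r|, and then the binary digits z_2, z_3, ... of its fractional part.  As
   usual both expansions of a dyadic rational are allowed. *)
Definition codes_real (R : realType) (z : nat -> nat) (r : R) : Prop :=
  [/\ (z 0 < 2)%N,
      forall i, (z i.+2 < 2)%N &
      (fun k : nat => (-1) ^+ z 0 *
         ((z 1)%:R + \sum_(i < k) (z i.+2)%:R / 2 ^+ i.+1) : R) @ \oo --> r].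

Definition codes_seq (R : realType) (y : nat -> nat) (ys : nat -> R) : Prop :=
  forall n, codes_real (nproj y n) (ys n).

(* The inverse of Cantor's pairing function: [unpair n] is the n-th pair of
   (0,0), (1,0), (0,1), (2,0), (1,1), (0,2), ... *)
Fixpoint unpair (n : nat) : nat * nat :=
  if n is m.+1 then
    let: (a, b) := unpair m in
    if a is a'.+1 then (a', b.+1) else (b.+1, 0%N)
  else (0%N, 0%N).

(* For n coding ((a, b), (d, e)), the interval from (a - b)/(d + 1) to
   (a - b + e + 1)/(d + 1).  Two rationals have a common denominator, so every
   nonempty bounded open interval with rational endpoints occurs. *)
Definition rat_interval (R : realType) (n : nat) : set R :=
  let: (i, j) := unpair n in
  let: (a, b) := unpair i in
  let: (d, e) := unpair j in
  [set u | (a%:R - b%:R) / d.+1%:R < u < (a%:R - b%:R + e.+1%:R) / d.+1%:R].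

Definition codes_open (R : realType) (a : nat -> nat) (G : set R) : Prop :=
  (forall n, (a n < 2)%N) /\
  G = \bigcup_(n in [set n | a n = 1%N]) rat_interval n.

Definition code_family (R : realType) (alpha : vset) : set (set R) :=
  [set G | [/\ open G,
               range (@ratr R) `<=` G &
               exists2 a, in_L alpha a & codes_open a G]].

(* Main.v *)
Require Import Defs.
From mathcomp Require Import all_boot all_order all_algebra.
From mathcomp Require Import all_classical all_reals all_analysis.
From mathcomp Require Import zify ring lra.
Import Order.TTheory GRing.Theory Num.Theory.
Import numFieldNormedType.Exports.

(** Each G_n contains the rationals, so it is open and dense, and by the Baire
    category theorem some c lies in all the sets G_n - y_m, so that y_m + c is in
    T for all m.
    To find a code of c in L_(alpha+omega), the category argument is run
    effectively.  A binary string is extended step by step, at stage (n, m) to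
    the least longer string all of whose real extensions c satisfy
    y_m + c in I_k for some k in the code of G_n.  This condition amounts to
    inequalities between natural numbers built from x, y and the truncated
    binary expansion of y_m, so the digits of c are arithmetical in x and y.
    Since x and y are in L_alpha, a transitive set, all natural numbers are in
    L_alpha and all finite relations between natural numbers are in
    L_(alpha+3).  Recursions can therefore be expressed over L_(alpha+3) by
    quantifying over their finite initial segments, so every function
    arithmetical in x and y is definable over L_(alpha+3). *)

Set Implicit Arguments.
Unset Strict Implicit.
Unset Printing Implicit Defensive.

Local Open Scope classical_set_scope.
Local Open Scope ring_scope.

(** * Well-founded sets and the constructible hierarchy *)

Lemma veq_refl x : veq x x.
Proof. by elim: x => A f IH /=; split=> i; exists i. Qed.

Lemma veq_sym x y : veq x y -> veq y x.
Proof.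
elim: x y => A f IH [B g] /= [fg gf]; split=> [j|i].
  by have [i /IH] := gf j; exists i.
by have [j /IH] := fg i; exists j.
Qed.

Lemma veq_trans y x z : veq x y -> veq y z -> veq x z.
Proof.
elim: x y z => A f IH [B g] [C h] /= [fg gf] [gh hg]; split=> [i|k].
  by have [j fgij] := fg i; have [k ghjk] := gh j; exists k; apply: IH ghjk.
by have [j ghjk] := hg k; have [i fgij] := gf j; exists i; apply: IH ghjk.
Qed.

Lemma veqP x y : veq x y <-> forall z, vmem z x <-> vmem z y.
Proof.
case: x y => A f [B g] /=; split=> [[fg gf] z|eq_fg].
  split=> -[/= i zi].
    by have [j] := fg i; exists j; apply: veq_trans zi _.
  by have [j /veq_sym] := gf i; exists j; apply: veq_trans zi _.
split=> [i|j].
  by have [|j] := (eq_fg (f i)).1; [exists i; apply: veq_refl | exists j].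
have [|i] := (eq_fg (g j)).2; first by exists j; apply: veq_refl.
by exists i; apply: veq_sym.
Qed.

Arguments veq : simpl never.

Lemma vmem_eql x x' y : veq x x' -> vmem x y -> vmem x' y.
Proof. by move=> /veq_sym xx' [j xj]; exists j; apply: veq_trans xj. Qed.

Lemma vmem_eqr x y y' : veq y y' -> vmem x y -> vmem x y'.
Proof. by move=> /veqP /(_ x) []. Qed.

Lemma vmem_velt x (i : vdom x) : vmem (velt i) x.
Proof. by exists i; apply: veq_refl. Qed.

Lemma vmem_irr x : ~ vmem x x.
Proof.
elim: x => A f IH [i xi].
by apply: (IH i); apply: vmem_eqr xi _; exists i; apply: veq_refl.
Qed.

Lemma vmem_upair z x y : vmem z (vupair x y) <-> veq z x \/ veq z y.
Proof.
by split=> [[[] /= ?]|[]?]; [left|right|exists true|exists false].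
Qed.

Lemma vupair_congr x x' y y' :
  veq x x' -> veq y y' -> veq (vupair x y) (vupair x' y').
Proof. by move=> xx' yy'; split=> -[]; by [exists true|exists false]. Qed.

Lemma vpair_congr x x' y y' :
  veq x x' -> veq y y' -> veq (vpair x y) (vpair x' y').
Proof. by move=> xx' yy'; do 2![apply: vupair_congr]; rewrite //; apply: vupair_congr. Qed.

Lemma veq_upair_sing x y z : veq (vupair x y) (vupair z z) -> veq x z /\ veq y z.
Proof.
move=> /veqP e; split.
  by have /vmem_upair[] : vmem x (vupair z z) by apply/e/vmem_upair; left; apply: veq_refl.
by have /vmem_upair[] : vmem y (vupair z z) by apply/e/vmem_upair; right; apply: veq_refl.
Qed.

Lemma vupair_inj_r x y y' : veq (vupair x y) (vupair x y') -> veq y y'.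
Proof.
move=> /veqP e.
have /vmem_upair[yx|//] : vmem y (vupair x y').
  by apply/e/vmem_upair; right; apply: veq_refl.
have /vmem_upair[y'x|/veq_sym//] : vmem y' (vupair x y).
  by apply/e/vmem_upair; right; apply: veq_refl.
exact: veq_trans yx (veq_sym y'x).
Qed.

Lemma vpair_inj x x' y y' :
  veq (vpair x y) (vpair x' y') -> veq x x' /\ veq y y'.
Proof.
move=> e.
have xx' : veq x x'.
  have /vmem_upair[] : vmem (vupair x x) (vpair x' y').
      apply: vmem_eqr e _; apply/vmem_upair; left; exact: veq_refl.
    by case/veq_upair_sing.
  by move/veq_sym/veq_upair_sing => [/veq_sym].
split=> //.
have {}e : veq (vpair x y) (vpair x y').
  by apply: veq_trans e _; apply: vpair_congr; [apply: veq_sym|apply: veq_refl].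
exact: vupair_inj_r (vupair_inj_r e).
Qed.

Lemma vmem_succ z x : vmem z (vsucc x) <-> vmem z x \/ veq z x.
Proof.
split=> [[[i|] /= zi]|[[i zi]|zx]]; [by left; exists i|by right| |].
  by exists (Some i).
by exists None.
Qed.

Lemma vmem_natP z n : vmem z (vnat n) <-> exists2 m, (m < n)%N & veq z (vnat m).
Proof.
elim: n => [|n IH]; first by split=> [[[]]|[]].
rewrite vmem_succ IH; split=> [[[m mn zm]|zn]|[m]].
- by exists m => //; apply: ltnW.
- by exists n.
- by rewrite ltnS leq_eqVlt => /orP[/eqP ->|mn] zm; [right|left; exists m].
Qed.

Lemma veq_nat m n : veq (vnat m) (vnat n) <-> m = n.
Proof.
split=> [mn|->]; last exact: veq_refl.
have [lt_mn|lt_nm|//] := ltngtP m n.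
- case: (@vmem_irr (vnat n)); apply: vmem_eql mn _.
  by apply/vmem_natP; exists m => //; apply: veq_refl.
- case: (@vmem_irr (vnat n)); apply: vmem_eqr mn _.
  by apply/vmem_natP; exists n => //; apply: veq_refl.
Qed.

Lemma vmem_nat m n : vmem (vnat m) (vnat n) <-> (m < n)%N.
Proof.
rewrite vmem_natP; split=> [[k kn /veq_nat->]//|mn].
by exists m => //; apply: veq_refl.
Qed.

Lemma vmem_vgraph m n x : vmem (vpair (vnat m) (vnat n)) (vgraph x) <-> x m = n.
Proof.
split=> [[k /vpair_inj[/veq_nat -> /veq_nat ->]]//|<-].
by exists m; apply: veq_refl.
Qed.

(** * Invariance of satisfaction and of the hierarchy under extensional equality *)

Lemma sat_congr X Y p (e : nat -> vdom X) (e' : nat -> vdom Y) : veq X Y ->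
  (forall i, veq (velt (e i)) (velt (e' i))) -> sat p e <-> sat p e'.
Proof.
move=> XY; elim: p e e' => [i j|i j|p IH|p IHp q IHq|p IH] e e' ee' /=.
- split=> ij.
    by apply: vmem_eql (ee' i) _; apply: vmem_eqr (ee' j) _.
  by apply: vmem_eql (veq_sym (ee' i)) _; apply: vmem_eqr (veq_sym (ee' j)) _.
- split=> ij.
    by apply: veq_trans (ee' j); apply: veq_trans (veq_sym (ee' i)) ij.
  by apply: veq_trans (veq_sym (ee' j)); apply: veq_trans (ee' i) ij.
- by rewrite (IH e e').
- by rewrite (IHp e e') // (IHq e e').
- split=> -[a pa].
    have [b ab] : vmem (velt a) Y by apply: vmem_eqr XY _; apply: vmem_velt.
    by exists b; apply: (IH _ _ _).1 pa; case.
  have [b ab] : vmem (velt a) X.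
    by apply: vmem_eqr (veq_sym XY) _; apply: vmem_velt.
  by exists b; apply: (IH _ _ _).2 pa; case=> //=; apply: veq_sym.
Qed.

Lemma vmem_vdef X p s u :
  vmem u (vdef p s) <-> exists2 z : vdom X, sat p (scons z (nth z s)) & veq u (velt z).
Proof.
split=> [[[z pz] uz]|[z pz uz]]; first by exists z.
by exists (exist _ z pz).
Qed.

Lemma vmem_vDef X u :
  vmem u (vDef X) <-> exists p (s : seq (vdom X)), veq u (vdef p s).
Proof. by split=> [[[p s] ?]|[p [s ?]]]; [exists p, s|exists (p, s)]. Qed.

Lemma vDef_sub X u w : vmem u (vDef X) -> vmem w u -> vmem w X.
Proof.
move=> /vmem_vDef[p [s us]] /(vmem_eqr us)/vmem_vdef[z _ wz].
by exists z.
Qed.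

(** The default of [nth] is the element under test itself, so the parameter lists are compared for
    every pair of equal defaults [z] and [z']. *)
Lemma vdef_congr X Y p (s : seq (vdom X)) (s' : seq (vdom Y)) : veq X Y ->
  (forall z z', veq (velt z) (velt z') ->
    forall i, veq (velt (nth z s i)) (velt (nth z' s' i))) ->
  veq (vdef p s) (vdef p s').
Proof.
move=> XY ss'; apply/veqP => u; rewrite !vmem_vdef; split=> -[z pz uz].
  have [z' zz'] : vmem (velt z) Y by apply: vmem_eqr XY _; apply: vmem_velt.
  exists z'; last exact: veq_trans uz zz'.
  by apply: (sat_congr _ XY _).1 pz; case=> //= i; apply: ss'.
have [z' /veq_sym zz'] : vmem (velt z) X.
  by apply: vmem_eqr (veq_sym XY) _; apply: vmem_velt.
exists z'; last exact: veq_trans uz (veq_sym zz').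
by apply: (sat_congr _ XY _).2 pz; case=> //= i; apply: ss'.
Qed.

Lemma vDef_congr_sub X Y u : veq X Y -> vmem u (vDef X) -> vmem u (vDef Y).
Proof.
move=> XY /vmem_vDef[p [s us]]; apply/vmem_vDef.
have [s' ss'] : exists s' : seq (vdom Y), forall z z', veq (velt z) (velt z') ->
    forall i, veq (velt (nth z s i)) (velt (nth z' s' i)).
  elim: s {us} => [|a s [s' IH]]; first by exists [::] => z z' zz' i; rewrite !nth_nil.
  have [b ab] : vmem (velt a) Y by apply: vmem_eqr XY _; apply: vmem_velt.
  by exists (b :: s') => z z' zz' [|i] //=; apply: IH.
by exists p, s'; apply: veq_trans us _; apply: vdef_congr.
Qed.

Lemma vmem_Lset u a :
  vmem u (Lset a) <-> exists i : vdom a, vmem u (vDef (Lset (velt i))).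
Proof.
case: a => A f; split=> [[[i j] uj]|[i [j uj]]]; first by exists i; exists j.
by exists (existT _ i j).
Qed.

Lemma Lset_congr a b : veq a b -> veq (Lset a) (Lset b).
Proof.
elim: a b => A f IH [B g] [fg gf]; apply/veqP => u; rewrite !vmem_Lset.
split=> -[/= i ui].
  by have [j /IH ij] := fg i; exists j; apply: vDef_congr_sub ui.
by have [j /IH/veq_sym ij] := gf i; exists j; apply: vDef_congr_sub ui.
Qed.

(** * Transitivity, successor levels and finite subsets in the hierarchy *)

Definition vtransitive X := forall u w, vmem u X -> vmem w u -> vmem w X.

(** A member of Def(L_b) is a subset of L_b, whose elements lie in Def(L_c) for some c in b; such a
    c is again in [a]. *)
Lemma Lset_trans a : is_ordinal a -> vtransitive (Lset a).
Proof.
move=> [tr_a _] u w /vmem_Lset[i ui] /(vDef_sub ui)/vmem_Lset[j wj].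
have [k jk] : vmem (velt j) a by apply: tr_a (vmem_velt i) (vmem_velt j).
by apply/vmem_Lset; exists k; apply: vDef_congr_sub wj; apply: Lset_congr.
Qed.

Lemma vmem_Lset_vadd u a b : vmem u (Lset (vadd a b)) <->
  vmem u (Lset a) \/ exists j : vdom b, vmem u (vDef (Lset (vadd a (velt j)))).
Proof.
case: b => B g; rewrite !vmem_Lset; split=> [[[i|j] /= u_]|[[i u_]|[j u_]]].
- by left; exists i.
- by right; exists j.
- by exists (inl i).
- by exists (inr j).
Qed.

Lemma Lset_addS u a n : vmem u (Lset (vadd a (vnat n.+1))) <->
  vmem u (Lset (vadd a (vnat n))) \/ vmem u (vDef (Lset (vadd a (vnat n)))).
Proof.
rewrite !vmem_Lset_vadd; split=> [[ua|[[j|] uj]]|[[ua|[j uj]]|un]].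
- by left; left.
- by left; right; exists j.
- by right.
- by left.
- by right; exists (Some j).
- by right; exists None.
Qed.

(** Induction on [n] replaces a proof that alpha + n is an ordinal: at a successor, members of
    members of Def(X) are in X. *)
Lemma Lset_add_trans a n : is_ordinal a -> vtransitive (Lset (vadd a (vnat n))).
Proof.
move=> a_ord; elim: n => [|n IH] u w.
  rewrite !vmem_Lset_vadd => -[ua|[[]]] wu; left.
  exact: Lset_trans ua wu.
rewrite !Lset_addS => -[un|un] wu; left; first exact: IH un wu.
exact: vDef_sub un wu.
Qed.

Lemma vDef_finite X (s : seq (vdom X)) :
  exists2 F, vmem F (vDef X) &
    forall u, vmem u F <-> exists2 i, (i < size s)%N & forall z, veq u (velt (nth z s i)).
Proof.
(* The disjunction of the equations z = s_i in De Morgan form; the empty disjunction is the false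
   formula z <> z. *)
pose p := foldr (fun i p => fneg (fand (fneg (feq 0 i.+1)) (fneg p)))
  (fneg (feq 0 0)).
have pP r z : sat (p r) (scons z (nth z s)) <->
    exists2 i, i \in r & veq (velt z) (velt (nth z s i)).
  elim: r => [|k r IH] /=.
    by split=> [[]|[i]]; [apply: veq_refl | rewrite in_nil].
  rewrite -/(p r); split=> [/not_andP[/contrapT|/contrapT]|[i]].
  - by exists k => //; rewrite mem_head.
  - by move=> /IH[i ir zi]; exists i => //; rewrite in_cons ir orbT.
  - rewrite in_cons => /predU1P[-> zk []//|ir zi [_]]; apply.
    by apply/IH; exists i.
exists (vdef (p (iota 0 (size s))) s).
  by apply/vmem_vDef; do 2!eexists; apply: veq_refl.
move=> u; rewrite vmem_vdef; split=> [[z /pP[i]]|[i si ui]].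
  rewrite mem_iota /= add0n => si zi uz; exists i => // z'.
  by rewrite (set_nth_default z) //; apply: veq_trans zi.
(* As [i < size s], the list is nonempty and supplies a default element. *)
have [z0] : exists z : vdom X, True by case: (s) si => // z; exists z.
move=> _; exists (nth z0 s i); last exact: ui.
apply/pP; exists i; first by rewrite mem_iota.
by rewrite (set_nth_default z0) //; apply: veq_refl.
Qed.

Lemma Lset_finite a k n (F : nat -> vset) :
  (forall i, vmem (F i) (Lset (vadd a (vnat k)))) ->
  vmem (vsup (fun i : 'I_n => F i)) (Lset (vadd a (vnat k.+1))).
Proof.
set X := Lset (vadd a (vnat k)) => FX; apply/Lset_addS; right.
have /boolp.choice[g gF] : forall i, exists j : vdom X, veq (F i) (velt j).
  by move=> i; have [j] := FX i; exists j.
have [H HX HP] := vDef_finite (mkseq g n); apply: vmem_eql HX.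
apply/veqP => u; rewrite HP size_mkseq; split=> [[i i_n ui]|[i ui]].
  exists (Ordinal i_n); apply: veq_trans (veq_sym (gF i)).
  by have := ui (g 0%N); rewrite nth_mkseq.
exists i => // z; rewrite nth_mkseq //; exact: veq_trans ui (gF i).
Qed.

(** * The generic branch of the binary tree *)

Section BinaryStrings.
Local Open Scope nat_scope.

Definition least (Q : nat -> Prop) : nat :=
  xget 0 [set n | Q n /\ forall k, Q k -> n <= k].

Lemma leastP (Q : nat -> Prop) : (exists n, Q n) ->
  Q (least Q) /\ forall k, Q k -> least Q <= k.
Proof.
move=> [n Qn].
have exQ : exists n, `[< Q n >] by exists n; apply/asboolP.
apply: (@xgetPex _ 0 [set n | Q n /\ forall k, Q k -> n <= k]).
case: (ex_minnP exQ) => m /asboolP Qm mP; exists m; split=> // k Qk.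
by apply: mP; apply/asboolP.
Qed.

(** A first-order description of the graph of [least], default value 0 included, from which
    [arith_fun_least] gets its definability. *)
Lemma least_eq Q v : v = least Q <->
  (Q v /\ forall k, Q k -> v <= k) \/ ((forall k, ~ Q k) /\ v = 0).
Proof.
have [exQ|nQ] := pselect (exists n, Q n).
  have [Qm mP] := leastP exQ; split=> [->|]; first by left.
  by case=> [[Qv vP]|[/(_ _ Qm)]//]; apply/eqP; rewrite eqn_leq vP //= mP.
have nQ' k : ~ Q k by move=> Qk; apply: nQ; exists k.
have -> : least Q = 0 by apply: xgetPN => n [/nQ'].
by split=> [->|]; [right|case=> [[/nQ']|[]]].
Qed.

(** Cantor's pairing polynomial, doubled to avoid the division by 2, so that decoding becomes a
    polynomial equation. *)
Definition codes_pair n a b := 2 * n = (a + b) * (a + b).+1 + 2 * b.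

Lemma codes_pairP n a b : codes_pair n a b <-> unpair n = (a, b).
Proof.
have unpairK m c d : unpair m = (c, d) -> codes_pair m c d.
  rewrite /codes_pair; elim: m c d => [|m IH] c d; first by case=> <- <-.
  rewrite [unpair _]/=; case E: (unpair m) => [[|a'] b'] [<- <-]; have {}IH := IH _ _ E;
    rewrite mulnS {}IH; ring.
split=> [nab|]; last exact: unpairK.
case E: (unpair n) => [c d]; have := unpairK _ _ _ E.
move: nab; rewrite /codes_pair => -> e.
(* The triangular numbers of s and s + 1 differ by s + 1, which exceeds the offset, so the code
   determines the diagonal. *)
have [lt_s|lt_s|eq_s] := ltngtP (a + b) (c + d).
- have : (a + b).+1 * (a + b).+2 <= (c + d) * (c + d).+1 by apply: leq_mul.
  by rewrite mulSn mulnS; lia.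
- have : (c + d).+1 * (c + d).+2 <= (a + b) * (a + b).+1 by apply: leq_mul.
  by rewrite mulSn mulnS; lia.
- by rewrite eq_s in e; congr pair; lia.
Qed.

Lemma codes_pair_exists a b : exists n, codes_pair n a b.
Proof.
have [t tE] : exists t, 2 * t = (a + b) * (a + b).+1.
  by elim: (a + b) => [|s [t tE]]; [exists 0|exists (t + s.+1); rewrite mulnDr tE; ring].
by exists (t + b); rewrite /codes_pair mulnDr tE.
Qed.

(* The number whose binary expansion is [1 s_0 ... s_(l-1)] stands for the
   binary string [s_0 ... s_(l-1)]. *)
Definition has_length l w := 2 ^ l <= w /\ w < 2 ^ l.+1.
(** Appending [j] binary digits to [v] gives exactly the numbers from v 2^j to (v + 1) 2^j - 1. *)
Definition extends v w := exists j, v * 2 ^ j <= w /\ w < v.+1 * 2 ^ j.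

Lemma extends_trans v u w : extends u v -> extends v w -> extends u w.
Proof.
move=> [j [uv vu]] [k [vw wv]]; exists (j + k).
have k0 : 0 < 2 ^ k by rewrite expn_gt0.
rewrite expnD !mulnA; split; first by apply: leq_trans vw; rewrite leq_pmul2r.
by apply: leq_trans wv _; rewrite leq_pmul2r.
Qed.

Lemma extends_refl v : extends v v.
Proof. by exists 0; rewrite expn0 !muln1; split. Qed.

Lemma has_length_inj l l' w : has_length l w -> has_length l' w -> l = l'.
Proof.
move=> [lw wl] [lw' wl'].
have := leq_ltn_trans lw wl'; have := leq_ltn_trans lw' wl.
by rewrite !ltn_exp2l // !ltnS => ? ?; apply/eqP; rewrite eqn_leq; apply/andP.
Qed.

Lemma has_length_mul l t b w : has_length l t ->
  t * 2 ^ b <= w -> w < t.+1 * 2 ^ b -> has_length (l + b) w.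
Proof.
move=> [lt tl] tw wt; have b0 : 0 < 2 ^ b by rewrite expn_gt0.
split; first by apply: leq_trans tw; rewrite expnD leq_pmul2r.
by apply: leq_trans wt _; rewrite -addSn expnD leq_pmul2r.
Qed.

(** The length of [w] fixes the number of digits appended, so [t] and [t'] are quotients of [w] by
    the same power of 2. *)
Lemma prefix_inj l t t' w : has_length l t -> has_length l t' ->
  extends t w -> extends t' w -> t = t'.
Proof.
move=> lt lt' [b [tw wt]] [b' [tw' wt']].
have /eqP := has_length_inj (has_length_mul lt tw wt) (has_length_mul lt' tw' wt').
rewrite eqn_add2l => /eqP bb'; rewrite -{b'}bb' in tw' wt'.
have b0 : 0 < 2 ^ b by rewrite expn_gt0.
have := leq_ltn_trans tw wt'; have := leq_ltn_trans tw' wt.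
by rewrite !ltn_pmul2r // !ltnS => ? ?; apply/eqP; rewrite eqn_leq; apply/andP.
Qed.

Lemma prefix_exists l k w : has_length k w -> l <= k ->
  exists2 t, has_length l t & extends t w.
Proof.
move=> [kw wk] lk; have b0 : 0 < 2 ^ (k - l) by rewrite expn_gt0.
exists (w %/ 2 ^ (k - l)); last first.
  by exists (k - l); split; [exact: leq_trunc_div|apply: ltn_ceil].
split; first by rewrite leq_divRL // -expnD subnKC.
by rewrite ltn_divLR // -expnD addSn subnKC.
Qed.

(** * The branch that meets a sequence of dense requirements *)

Section Branch.
Variable Q : nat -> nat -> Prop.

(** The start 1 is the empty string. The condition [v < w] excludes the trivial extension, so the
    length grows at every stage. *)
Definition node s :=
  iteri s (fun i v => least (fun w => v < w /\ extends v w /\ Q i w)) 1.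
Definition branch l := least (fun t => has_length l t /\ extends t (node l)).

Hypothesis Q_dense : forall i l v, has_length l v ->
  exists w, v < w /\ extends v w /\ Q i w.

Lemma node_length s : exists2 l, s <= l & has_length l (node s).
Proof.
elim: s => [|s [l sl ls]]; first by exists 0.
have [[lt_v [[b [vw wv]] _]] _] := leastP (Q_dense s ls).
exists (l + b); last exact: has_length_mul ls vw wv.
case: b vw wv => [|b _ _]; last by rewrite addnS ltnS (leq_trans sl) ?leq_addr.
by rewrite expn0 !muln1 ltnS => _ /(leq_trans lt_v); rewrite ltnn.
Qed.

Lemma node_step s : Q s (node s.+1) /\ extends (node s) (node s.+1).
Proof.
have [l _ ls] := node_length s.
by have [[_ []]] := leastP (Q_dense s ls).
Qed.

Lemma node_extends s s' : s <= s' -> extends (node s) (node s').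
Proof.
move=> /subnK <-; elim: (s' - s) => [|k IH]; first exact: extends_refl.
exact: extends_trans IH (node_step _).2.
Qed.

Lemma branchP l : has_length l (branch l) /\ extends (branch l) (node l).
Proof.
have [k lk kl] := node_length l; have [t lt tl] := prefix_exists kl lk.
by case: (@leastP (fun t => has_length l t /\ extends t (node l))) => //; exists t.
Qed.

Lemma branch0 : branch 0 = 1.
Proof. by have [[]] := branchP 0; case: branch => [|[|n]]. Qed.

(** Both [branch l] and the half of [branch l.+1] are prefixes of length [l] of [node l.+1], hence
    equal. *)
Lemma branchS l : branch l.+1 = 2 * branch l + odd (branch l.+1).
Proof.
have [ll le] := branchP l; have [lSl leS] := branchP l.+1.
rewrite {1}[LHS](divn_eq _ 2) modn2 mulnC; congr (2 * _ + _).
have le' : extends (branch l) (node l.+1) by apply: extends_trans le (node_extends _).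
apply: (@prefix_inj l) (node l.+1) _ ll _ le'.
  case: lSl => h1 h2; split; first by rewrite leq_divRL // mulnC -expnS.
  by rewrite ltn_divLR // mulnC -expnS.
apply: extends_trans leS; exists 1; rewrite expn1.
by split; [exact: leq_trunc_div|apply: ltn_ceil].
Qed.

(** If [l] is the length of [node i.+1], then i < l and [node l] extends [node i.+1], which is
    therefore its prefix [branch l]. *)
Lemma branch_meets i : exists2 l, has_length l (branch l) & Q i (branch l).
Proof.
have [l il li] := node_length i.+1; exists l; first by have [] := branchP l.
suff -> : branch l = node i.+1 by have [] := node_step i.
have [ll le] := branchP l.
exact: (prefix_inj ll li le (node_extends il)).
Qed.

(* A code of [1 + \sum_k odd (branch k.+1) / 2 ^ k.+1]. *)
Definition shift_code n :=
  match n with 0 => 0 | 1 => 1 | k.+2 => nat_of_bool (odd (branch k.+1)) end.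

(** The graph of [shift_code] in first-order terms: parity is expressed through the quotient [t]. *)
Definition is_shift_code n v :=
  (n = 0 /\ v = 0) \/ (n = 1 /\ v = 1) \/
  exists k t, n = k.+2 /\ branch k.+1 = 2 * t + v /\ v <= 1.

Lemma shift_codeE n v : v = shift_code n <-> is_shift_code n v.
Proof.
split; last first.
  move=> [[-> ->]|[[-> ->]|[k [t [-> [bE v1]]]]]]; [by []|by []|].
  rewrite /shift_code bE oddD mul2n odd_double.
  by case: v v1 {bE} => [|[|]].
case: n => [|[|k]] ->; [by left|by right; left|right; right].
exists k, (branch k.+1)./2; split; first by [].
split; last by rewrite /shift_code leq_b1.
by rewrite /shift_code mul2n addnC odd_double_half.
Qed.

End Branch.

(* [digits_approx y m l / 2 ^ l] truncates the absolute value of the real coded by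
   [nproj y m] to [l] binary digits. *)
Definition digits_approx (y : nat -> nat) m l :=
  iteri l (fun i v => 2 * v + nproj y m i.+2) (nproj y m 1).

(* If [p - q] is the integer such that the [m]-th real of the sequence [y] lies
   between [(p - q) / 2 ^ l] and [(p - q + 1) / 2 ^ l], then the last two
   inequalities, cleared of denominators and signs, say that
   [[w / 2 ^ l, (w + 1) / 2 ^ l]] translated by that real lies in the [k]-th
   rational interval. *)
Definition requirement (x y : nat -> nat) s w :=
  exists n m, codes_pair s n m /\
  exists l k, has_length l w /\ nproj x n k = 1 /\
  exists i j, codes_pair k i j /\
  exists a b, codes_pair i a b /\
  exists d e, codes_pair j d e /\
  exists p q,
    ((nproj y m 0 = 0 /\ p = digits_approx y m l /\ q = 0) \/
     (nproj y m 0 = 1 /\ p = 0 /\ q = (digits_approx y m l).+1)) /\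
    a * 2 ^ l + d.+1 * q < d.+1 * (w + p) + b * 2 ^ l /\
    d.+1 * (w + p + 2) + b * 2 ^ l < (a + e.+1) * 2 ^ l + d.+1 * q.

End BinaryStrings.

(** * Relations arithmetical in two oracles *)

Fixpoint frename (r : nat -> nat) (p : fml) : fml :=
  match p with
  | fmem i j => fmem (r i) (r j)
  | feq i j => feq (r i) (r j)
  | fneg p => fneg (frename r p)
  | fand p q => fand (frename r p) (frename r q)
  | fex p => fex (frename (fun i => if i is j.+1 then (r j).+1 else 0%N) p)
  end.

Lemma sat_frename X p r (e : nat -> vdom X) :
  sat (frename r p) e <-> sat p (fun i => e (r i)).
Proof.
elim: p r e => [i j|i j|p IH|p IHp q IHq|p IH] r e //=.
- by rewrite IH.
- by rewrite IHp IHq.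
- have sc a : (fun i => scons a e (if i is j.+1 then (r j).+1 else 0%N)) =
              scons a (fun i => e (r i)) by apply/funext; case.
  by split=> -[a pa]; exists a; move: pa; rewrite IH sc.
Qed.

Definition fimp p q := fneg (fand p (fneg q)).
Definition fall p := fneg (fex (fneg p)).
Definition fupair i j k :=
  fall (fand (fimp (fmem 0 k.+1) (fneg (fand (fneg (feq 0 i.+1)) (fneg (feq 0 j.+1)))))
             (fand (fmem i.+1 k.+1) (fmem j.+1 k.+1))).
Definition fpair i j k :=
  fex (fex (fand (fand (fupair i.+2 i.+2 1) (fupair i.+2 j.+2 0)) (fupair 1 0 k.+2))).
Definition fpair_in i j k := fex (fand (fpair i.+1 j.+1 0) (fmem 0 k.+1)).

(** With the next two lemmas this is the interface to [sat], which is then made opaque to keep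
    formulas folded. *)
Lemma satE X (e : nat -> vdom X) :
  (forall i j, sat (fmem i j) e = vmem (velt (e i)) (velt (e j))) *
  (forall i j, sat (feq i j) e = veq (velt (e i)) (velt (e j))) *
  (forall p, sat (fneg p) e = ~ sat p e).
Proof. by []. Qed.

Lemma sat_fand X p q (e : nat -> vdom X) : sat (fand p q) e <-> sat p e /\ sat q e.
Proof. by []. Qed.

Lemma sat_fex X p (e : nat -> vdom X) : sat (fex p) e <-> exists a, sat p (scons a e).
Proof. by []. Qed.

Opaque sat.

Lemma sat_fimp X p q (e : nat -> vdom X) :
  sat (fimp p q) e <-> (sat p e -> sat q e).
Proof.
rewrite /fimp !satE sat_fand satE.
by split=> [+ pe|pq [pe]] => [/not_andP[//|/contrapT]|]; apply; apply: pq.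
Qed.

Lemma sat_fall X p (e : nat -> vdom X) :
  sat (fall p) e <-> forall a, sat p (scons a e).
Proof.
rewrite /fall satE sat_fex; split=> [np a|ap [a]]; last by rewrite satE; apply; apply: ap.
by apply: contrapT => npa; apply: np; exists a; rewrite satE.
Qed.

(** * Absoluteness of pairs for transitive sets *)

Section Transitive.
Context (X : vset) (X_tr : vtransitive X).
Implicit Type e : nat -> vdom X.

Lemma sat_fupair e i j k :
  sat (fupair i j k) e <-> veq (velt (e k)) (vupair (velt (e i)) (velt (e j))).
Proof.
have h a : sat (fand (fimp (fmem 0 k.+1)
      (fneg (fand (fneg (feq 0 i.+1)) (fneg (feq 0 j.+1)))))
      (fand (fmem i.+1 k.+1) (fmem j.+1 k.+1))) (scons a e) <->
    (vmem (velt a) (velt (e k)) -> veq (velt a) (velt (e i)) \/ veq (velt a) (velt (e j)))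
    /\ vmem (velt (e i)) (velt (e k)) /\ vmem (velt (e j)) (velt (e k)).
  rewrite !(sat_fand, sat_fimp, satE) /= not_andE !notE.
  by [].
rewrite sat_fall; split=> [eijk|/veqP ek a].
  apply/veqP => z; rewrite vmem_upair; split=> [zk|].
    have [a za] := X_tr (vmem_velt (e k)) zk.
    have /h[+ _] := eijk a; move=> /(_ (vmem_eql za zk)) az.
    by case: az => az; [left|right]; apply: veq_trans za az.
  (* These two memberships stand under the quantifier without its variable, so any instance yields
     them. *)
  have /h[_ [ik jk]] := eijk (e i).
  by case=> /veq_sym zi; apply: vmem_eql zi _.
apply/h; split; first by move=> /ek/vmem_upair.
by split; apply/ek/vmem_upair; [left|right]; apply: veq_refl.
Qed.

(** The two sets that [fpair] quantifies over are members of the Kuratowski pair, hence in [X] by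
    transitivity. *)
Lemma sat_fpair e i j k :
  sat (fpair i j k) e <-> veq (velt (e k)) (vpair (velt (e i)) (velt (e j))).
Proof.
split=> [/sat_fex[a /sat_fex[b /sat_fand[/sat_fand[]]]]|ek].
  move=> /sat_fupair /= a_ /sat_fupair /= b_ /sat_fupair /= ek.
  by apply: veq_trans ek _; apply: vupair_congr.
have uX b : vmem b (vpair (velt (e i)) (velt (e j))) -> vmem b X.
  by move=> bk; apply: X_tr (vmem_velt (e k)) _; apply: vmem_eqr (veq_sym ek) _.
have [|a a_] := uX (vupair (velt (e i)) (velt (e i))).
  by apply/vmem_upair; left; apply: veq_refl.
have [|b b_] := uX (vupair (velt (e i)) (velt (e j))).
  by apply/vmem_upair; right; apply: veq_refl.
apply/sat_fex; exists a; apply/sat_fex; exists b; apply/sat_fand; split.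
  by apply/sat_fand; split; apply/sat_fupair => /=; apply: veq_sym.
by apply/sat_fupair => /=; apply: veq_trans ek _; apply: vupair_congr.
Qed.

Lemma sat_fpair_in e i j k : sat (fpair_in i j k) e <->
  vmem (vpair (velt (e i)) (velt (e j))) (velt (e k)).
Proof.
split=> [/sat_fex[a /sat_fand[/sat_fpair /= a_]]|ijk].
  by rewrite satE /= => ak; apply: vmem_eql a_ ak.
have [a a_] := X_tr (vmem_velt (e k)) ijk.
apply/sat_fex; exists a; apply/sat_fand.
split; first by apply/sat_fpair; apply: veq_sym.
rewrite satE; exact: vmem_eql a_ ijk.
Qed.

Lemma vpair_trans a b c : vmem c X -> vmem (vpair a b) c -> vmem a X /\ vmem b X.
Proof.
move=> cX /(X_tr cX) abX.
have uX : vmem (vupair a b) X.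
  by apply: X_tr abX _; apply/vmem_upair; right; apply: veq_refl.
by split; apply: X_tr uX _; apply/vmem_upair; [left|right]; apply: veq_refl.
Qed.

End Transitive.

(** Says that [i] is in the domain of [k]. For the graph of the total function [x] this domain is
    the set of natural numbers, which is thus singled out without assuming omega in [X]. *)
Definition fnat i k := fex (fpair_in i.+1 0 k.+1).

Section Arithmetical.
Context (X : vset) (x y : nat -> nat).
Hypotheses (X_tr : vtransitive X)
  (X_x : vmem (vgraph x) X) (X_y : vmem (vgraph y) X)
  (X_fin : forall n (v : nat -> nat),
    vmem (vsup (fun i : 'I_n => vpair (vnat i) (vnat (v i)))) X).
Local Open Scope nat_scope.

Lemma sat_fnat e i k : veq (velt (e k)) (vgraph x) ->
  sat (fnat i k) e <-> exists n, veq (@velt X (e i)) (vnat n).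
Proof.
move=> ek; split=> [/sat_fex[a /(sat_fpair_in X_tr)]|[n ein]].
  by move=> /= /(vmem_eqr ek)[n /vpair_inj[]]; exists n.
have [a xna] : vmem (vnat (x n)) X.
  have xn : vmem (vpair (vnat n) (vnat (x n))) (vgraph x) by apply/vmem_vgraph.
  exact: (proj2 (vpair_trans X_tr X_x xn)).
apply/sat_fex; exists a; apply/(sat_fpair_in X_tr) => /=; apply: vmem_eqr (veq_sym ek) _.
apply: vmem_eql (vpair_congr (veq_sym ein) xna) _; exact/vmem_vgraph.
Qed.

Lemma vnat_in n : exists a : vdom X, veq (vnat n) (velt a).
Proof.
have xn : vmem (vpair (vnat n) (vnat (x n))) (vgraph x) by apply/vmem_vgraph.
exact: (proj1 (vpair_trans X_tr X_x xn)).
Qed.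

(* Variables 0 and 1 of a formula are the oracles [x] and [y], variable 2 is an
   arbitrary set, and the variables from 3 on are natural numbers. *)
Definition interprets (f : vdom X) (e : nat -> nat) (E : nat -> vdom X) :=
  [/\ veq (velt (E 0)) (vgraph x), veq (velt (E 1)) (vgraph y), E 2 = f &
      forall i, veq (velt (E i.+3)) (vnat (e i))].

(** The set argument of [P] makes room for the graph of a finite piece of a recursion, later bound
    by [arith_exset]. *)
Definition arith (P : vdom X -> (nat -> nat) -> Prop) :=
  exists p, forall f e E, interprets f e E -> sat p E <-> P f e.

Definition arith_fun (t : (nat -> nat) -> nat) :=
  arith (fun _ e => e 0 = t (fun i => e i.+1)).

Lemma arith_ext P Q : (forall f e, P f e <-> Q f e) -> arith P -> arith Q.
Proof. by move=> PQ [p pP]; exists p => f e E eE; rewrite -PQ; apply: pP. Qed.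

Lemma arith_not P : arith P -> arith (fun f e => ~ P f e).
Proof. by move=> [p pP]; exists (fneg p) => f e E eE; rewrite satE (pP f e). Qed.

Lemma arith_and P Q : arith P -> arith Q -> arith (fun f e => P f e /\ Q f e).
Proof.
move=> [p pP] [q qQ]; exists (fand p q) => f e E eE.
by rewrite sat_fand (pP f e) // (qQ f e).
Qed.

Lemma arith_imp P Q : arith P -> arith Q -> arith (fun f e => P f e -> Q f e).
Proof.
move=> [p pP] [q qQ]; exists (fimp p q) => f e E eE.
by rewrite sat_fimp (pP f e) // (qQ f e).
Qed.

Lemma arith_or P Q : arith P -> arith Q -> arith (fun f e => P f e \/ Q f e).
Proof.
move=> aP aQ; apply: arith_ext (arith_imp (arith_not aP) aQ) => f e.
by split=> [PQ|[//|//]]; have [|/PQ] := pselect (P f e); [left|right].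
Qed.

Lemma arith_ren P (r : nat -> nat) :
  arith P -> arith (fun f e => P f (fun i => e (r i))).
Proof.
move=> [p pP].
exists (frename (fun i => if i is j.+3 then (r j).+3 else i) p) => f e E [Ex Ey Ef Ee].
by rewrite sat_frename; apply: pP; split.
Qed.

Lemma arith_exset P : arith P -> arith (fun _ e => exists f, P f e).
Proof.
move=> [p pP].
(* The quantifier puts its witness in place 0 and shifts the rest by one; the renaming makes the
   witness play the set, variable 2. *)
exists (fex (frename (fun i => match i with 0 => 1 | 1 => 2 | 2 => 0 | _ => i.+1 end) p)).
move=> f e E [Ex Ey Ef Ee].
suff h a : sat (frename (fun i => match i with 0 => 1 | 1 => 2 | 2 => 0 | _ => i.+1 end) p)
    (scons a E) <-> P a e.
  by rewrite sat_fex; split=> -[a ?]; exists a; apply/h.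
by rewrite sat_frename; apply: pP; split.
Qed.

Lemma arith_ex (P : vdom X -> nat -> (nat -> nat) -> Prop) :
  arith (fun f e => P f (e 0) (fun i => e i.+1)) ->
  arith (fun f e => exists n, P f n e).
Proof.
move=> [p pP].
(* The witness, in place 0, becomes the first number variable 3. From 4 on, the shift by the
   quantifier and the shift in [P] cancel. *)
pose r i := match i with 0 => 1 | 1 => 2 | 2 => 3 | 3 => 0 | _ => i end.
exists (fex (fand (fnat 0 1) (frename r p))) => f e E [Ex Ey Ef Ee].
have h a n : veq (velt a) (vnat n) -> sat (frename r p) (scons a E) <-> P f n e.
  by move=> an; rewrite sat_frename (pP f (scons n e)) //; split=> // -[].
split=> [/sat_fex[a /sat_fand[/sat_fnat -/(_ Ex)[n an]]]|[n Pn]].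
  by move=> /(h _ _ an); exists n.
have [a /veq_sym na] := vnat_in n; apply/sat_fex; exists a; apply/sat_fand.
split; last exact/(h _ _ na).
by apply/sat_fnat => //; exists n.
Qed.

Lemma arith_all (P : vdom X -> nat -> (nat -> nat) -> Prop) :
  arith (fun f e => P f (e 0) (fun i => e i.+1)) ->
  arith (fun f e => forall n, P f n e).
Proof.
move=> /arith_not /(@arith_ex (fun f n e => ~ P f n e))/arith_not.
by apply: arith_ext => f e; split=> [/forallNP + n|? [n]] => [/(_ n)/contrapT|[]].
Qed.

Lemma arith_subst (P : vdom X -> nat -> (nat -> nat) -> Prop) t :
  arith_fun t -> arith (fun f e => P f (e 0) (fun i => e i.+1)) ->
  arith (fun f e => P f (t e) e).
Proof.
move=> at_ aP.
have := @arith_ex (fun f n e => n = t e /\ P f n e) (arith_and at_ aP).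
by apply: arith_ext => f e; split=> [[_ [->]]|]; [|exists (t e)].
Qed.

Lemma arith_fun_ren t (r : nat -> nat) :
  arith_fun t -> arith_fun (fun e => t (fun i => e (r i))).
Proof. exact: (@arith_ren _ (fun i => if i is j.+1 then (r j).+1 else 0)). Qed.

Lemma arith_fun_subst (t : nat -> (nat -> nat) -> nat) u :
  arith_fun u -> arith_fun (fun e => t (e 0) (fun i => e i.+1)) ->
  arith_fun (fun e => t (u e) e).
Proof.
move=> au at_.
apply: (@arith_subst (fun _ v e => e 0 = t v (fun i => e i.+1))).
  exact: arith_fun_ren.
exact: (@arith_ren _ (fun i => match i with 0 => 1 | 1 => 0 | _ => i end) at_).
Qed.

Lemma arith_fun_var i : arith_fun (fun e => e i).
Proof.
exists (feq 3 i.+4) => f e E [_ _ _ Ee]; rewrite satE -veq_nat; split=> e0.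
  by apply: veq_trans (veq_sym (Ee 0)) _; apply: veq_trans e0 _; apply: Ee.
by apply: veq_trans (Ee 0) _; apply: veq_trans e0 _; apply/veq_sym/Ee.
Qed.

Lemma arith_eq t u : arith_fun t -> arith_fun u -> arith (fun _ e => t e = u e).
Proof.
move=> at_ au; apply: (@arith_subst (fun _ v e => v = u e)) => //.
Qed.

Lemma arith_lt t u : arith_fun t -> arith_fun u -> arith (fun _ e => t e < u e).
Proof.
move=> at_ au; apply: (@arith_subst (fun _ v e => v < u e)) => //.
apply: (@arith_subst (fun _ v e => e 0 < v)); first exact: arith_fun_ren.
(* The order of von Neumann numerals is membership. *)
exists (fmem 4 3) => f e E [_ _ _ Ee]; rewrite satE -vmem_nat; split=> e0.
  by apply: vmem_eql (Ee 1) _; apply: vmem_eqr (Ee 0) _.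
by apply: vmem_eql (veq_sym (Ee 1)) _; apply: vmem_eqr (veq_sym (Ee 0)) _.
Qed.

Lemma arith_le t u : arith_fun t -> arith_fun u -> arith (fun _ e => t e <= u e).
Proof.
move=> at_ au; apply: arith_ext (arith_not (arith_lt au at_)) => f e.
by rewrite (leqNgt (t e)); split=> /negP.
Qed.

Lemma arith_pair_in t u : arith_fun t -> arith_fun u ->
  arith (fun f e => vmem (vpair (vnat (t e)) (vnat (u e))) (velt f)).
Proof.
move=> at_ au.
apply: (@arith_subst (fun f v e => vmem (vpair (vnat v) (vnat (u e))) (velt f))) => //.
apply: (@arith_subst (fun f v e => vmem (vpair (vnat (e 0)) (vnat v)) (velt f))).
  exact: arith_fun_ren.
exists (fpair_in 4 3 2) => f e E [_ _ <- Ee]; rewrite (sat_fpair_in X_tr).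
split; apply: vmem_eql; apply: vpair_congr; rewrite //; exact: veq_sym.
Qed.

Lemma arith_fun_oracle t (z : nat -> nat) : z = x \/ z = y ->
  arith_fun t -> arith_fun (fun e => z (t e)).
Proof.
move=> zxy at_; apply: (@arith_fun_subst (fun v _ => z v)) => //.
have [k kz] : exists k, forall f e E, interprets f e E -> veq (velt (E k)) (vgraph z).
  by case: zxy => ->; [exists 0|exists 1] => f e E [].
exists (fpair_in 4 3 k) => f e E /[dup] eE [_ _ _ Ee]; rewrite (sat_fpair_in X_tr).
have ee := vpair_congr (Ee 1) (Ee 0); split=> e0.
  by apply/esym/vmem_vgraph; apply: vmem_eql ee _; apply: vmem_eqr (kz _ _ _ eE) _.
apply: vmem_eql (veq_sym ee) _; apply: vmem_eqr (veq_sym (kz _ _ _ eE)) _.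
exact/vmem_vgraph/esym.
Qed.

Lemma arith_fun_succ t : arith_fun t -> arith_fun (fun e => (t e).+1).
Proof.
move=> at_; apply: (@arith_fun_subst (fun v _ => v.+1)) => //.
(* The successor is the least number above, a condition on the order alone. *)
pose P (f : vdom X) e := e 1 < e 0 /\ forall k, e 1 < k -> e 0 <= k.
apply: (@arith_ext P) => [f e|].
  split=> [[e10 /(_ (e 1).+1 (ltnSn _)) e01]|e0]; last by rewrite /P e0; split.
  by apply/eqP; rewrite eqn_leq e01.
apply: arith_and; first by apply: arith_lt; apply: arith_fun_var.
apply: (@arith_all (fun f k e => e 1 < k -> e 0 <= k)); apply: arith_imp.
  by apply: arith_lt; apply: arith_fun_var.
by apply: arith_le; apply: arith_fun_var.
Qed.

Lemma arith_fun_const n : arith_fun (fun=> n).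
Proof.
elim: n => [|n IH]; last exact: arith_fun_succ.
apply: (@arith_ext (fun _ e => forall k, e 0 <= k)) => [f e|].
  by split=> [/(_ 0)|->//]; rewrite leqn0 => /eqP.
apply: (@arith_all (fun f k e => e 0 <= k)).
by apply: arith_le; apply: arith_fun_var.
Qed.

(** [X_fin] supplies the graph of the recursion on 0, ..., n. Conversely, by induction, the
    conditions leave only the right value at each i <= n, whatever else [f] contains. *)
Lemma iteri_graphP n g a w : w = iteri n g a <->
  exists f : vdom X, [/\
    forall v, vmem (vpair (vnat 0) (vnat v)) (velt f) -> v = a,
    forall i u v, vmem (vpair (vnat i) (vnat u)) (velt f) ->
      vmem (vpair (vnat i.+1) (vnat v)) (velt f) -> v = g i u,
    forall i, i <= n -> exists v, vmem (vpair (vnat i) (vnat v)) (velt f) &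
    vmem (vpair (vnat n) (vnat w)) (velt f)].
Proof.
split=> [->|[f [f0 fS fn fw]]].
  have [f hf] := X_fin n.+1 (fun i => iteri i g a); exists f.
  have fP i v : vmem (vpair (vnat i) (vnat v)) (velt f) <-> i <= n /\ v = iteri i g a.
    split=> [/(vmem_eqr (veq_sym hf))[j /vpair_inj[/veq_nat -> /veq_nat ->]]|[i_n ->]].
      by have := ltn_ord j; rewrite ltnS.
    by apply: vmem_eqr hf _; exists (Ordinal (i_n : i < n.+1)); apply: veq_refl.
  by split=> [v /fP[]|i u v /fP[_ ->] /fP[_ ->]|i i_n|] //; last exact/fP;
     exists (iteri i g a); apply/fP.
have h i v : i <= n -> vmem (vpair (vnat i) (vnat v)) (velt f) -> v = iteri i g a.
  elim: i v => [|i IH] v i_n; first exact: f0.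
  have [u fu] := fn i (ltnW i_n).
  by move=> /(fS _ _ _ fu) ->; rewrite (IH _ (ltnW i_n) fu).
exact: h fw.
Qed.

Lemma arith_fun_iteri n a (g : nat -> nat -> (nat -> nat) -> nat) :
  arith_fun n -> arith_fun a ->
  arith_fun (fun e => g (e 0) (e 1) (fun i => e i.+2)) ->
  arith_fun (fun e => iteri (n e) (fun i v => g i v e) (a e)).
Proof.
move=> an aa ag.
pose P (f : vdom X) (e : nat -> nat) :=
  (forall v, vmem (vpair (vnat 0) (vnat v)) (velt f) -> v = a (fun i => e i.+1)) /\
  (forall i u v, vmem (vpair (vnat i) (vnat u)) (velt f) ->
      vmem (vpair (vnat i.+1) (vnat v)) (velt f) -> v = g i u (fun i => e i.+1)) /\
  (forall i, i <= n (fun i => e i.+1) -> exists v, vmem (vpair (vnat i) (vnat v)) (velt f)) /\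
  vmem (vpair (vnat (n (fun i => e i.+1))) (vnat (e 0))) (velt f).
apply: (@arith_ext (fun _ e => exists f, P f e)) => [f e|].
  rewrite iteri_graphP; split=> -[h]; first by case=> ? [? [? ?]]; exists h.
  by case=> ? ? ? ?; exists h.
apply: arith_exset; apply: arith_and.
  apply: (@arith_all (fun f v e => vmem (vpair (vnat 0) (vnat v)) (velt f) ->
    v = a (fun i => e i.+1))).
  apply: arith_imp.
    by apply: arith_pair_in; [apply: arith_fun_const|apply: arith_fun_var].
  by apply: arith_eq; [apply: arith_fun_var|apply: (arith_fun_ren (fun i => i.+2))].
apply: arith_and.
  apply: (@arith_all (fun f i e => forall u v, vmem (vpair (vnat i) (vnat u)) (velt f) ->
      vmem (vpair (vnat i.+1) (vnat v)) (velt f) -> v = g i u (fun i => e i.+1))).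
  apply: (@arith_all (fun f u e => forall v, vmem (vpair (vnat (e 0)) (vnat u)) (velt f) ->
      vmem (vpair (vnat (e 0).+1) (vnat v)) (velt f) -> v = g (e 0) u (fun i => e i.+2))).
  apply: (@arith_all (fun f v e => vmem (vpair (vnat (e 1)) (vnat (e 0))) (velt f) ->
      vmem (vpair (vnat (e 1).+1) (vnat v)) (velt f) -> v = g (e 1) (e 0) (fun i => e i.+3))).
  apply: arith_imp; first by apply: arith_pair_in; apply: arith_fun_var.
  apply: arith_imp; first by apply: arith_pair_in;
    [apply: arith_fun_succ|]; apply: arith_fun_var.
  apply: arith_eq; first exact: arith_fun_var.
  (* Variables 0, 1, 2 are now [v], [u], [i], variable 3 is the value of the whole recursion, and
     the parameters start at 4. *)
  exact: (arith_fun_ren (fun i => match i with 0 => 2 | 1 => 1 | _ => i.+2 end) ag).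
apply: arith_and; last first.
  apply: arith_pair_in; last exact: arith_fun_var.
  exact: (arith_fun_ren (fun i => i.+1)).
apply: (@arith_all (fun f i e => i <= n (fun i => e i.+1) ->
  exists v, vmem (vpair (vnat i) (vnat v)) (velt f))).
apply: arith_imp; first by apply: arith_le;
  [apply: arith_fun_var|apply: (arith_fun_ren (fun i => i.+2))].
apply: (@arith_ex (fun f v e => vmem (vpair (vnat (e 0)) (vnat v)) (velt f))).
by apply: arith_pair_in; apply: arith_fun_var.
Qed.

Lemma arith_fun_add t u : arith_fun t -> arith_fun u -> arith_fun (fun e => t e + u e).
Proof.
move=> at_ au; rewrite (_ : (fun e => _) = (fun e => iteri (u e) (fun _ v => v.+1) (t e))).
  apply: (@arith_fun_iteri _ _ (fun _ v _ => v.+1)) => //.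
  by apply: arith_fun_succ; apply: arith_fun_var.
by apply/funext => e; elim: (u e) => [|k /= <-]; rewrite ?addn0 ?addnS.
Qed.

Lemma arith_fun_mul t u : arith_fun t -> arith_fun u -> arith_fun (fun e => t e * u e).
Proof.
move=> at_ au; rewrite (_ : (fun e => _) = (fun e => iteri (u e) (fun _ v => v + t e) 0)).
  apply: (@arith_fun_iteri _ _ (fun _ v e => v + t e)) => //; first exact: arith_fun_const.
  by apply: arith_fun_add; [apply: arith_fun_var|apply: (arith_fun_ren (fun i => i.+2))].
by apply/funext => e; elim: (u e) => [|k /= <-]; rewrite ?muln0 ?mulnSr.
Qed.

Lemma arith_fun_exp t u : arith_fun t -> arith_fun u -> arith_fun (fun e => t e ^ u e).
Proof.
move=> at_ au; rewrite (_ : (fun e => _) = (fun e => iteri (u e) (fun _ v => v * t e) 1)).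
  apply: (@arith_fun_iteri _ _ (fun _ v e => v * t e)) => //; first exact: arith_fun_const.
  by apply: arith_fun_mul; [apply: arith_fun_var|apply: (arith_fun_ren (fun i => i.+2))].
by apply/funext => e; elim: (u e) => [|k /= <-]; rewrite ?expn0 ?expnSr.
Qed.

(** The graph of [z] is the set of w in X equal to a pair (n, m) of numbers with m = z(n), defined
    with the graphs of [x] and [y] as parameters. *)
Lemma arith_vDef (z : nat -> nat) :
  arith_fun (fun e => z (e 0)) -> vmem (vgraph z) (vDef X).
Proof.
move=> [p pz]; have [gx Ex] := X_x; have [gy Ey] := X_y.
(* Places 0 to 4 hold m, n, w and the two parameters. The set variable is read as w, and every
   number variable after the first as n. *)
pose r i := match i with 0 => 3 | 1 => 4 | 2 => 2 | 3 => 0 | _ => 1 end.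
pose q := fand (fnat 1 3) (fand (fnat 0 3) (fand (fpair 1 0 2) (frename r p))).
apply/vmem_vDef; exists (fex (fex q)), [:: gx; gy]; apply/veqP => u.
have hP a n b m w : veq (velt a) (vnat n) -> veq (velt b) (vnat m) ->
    sat (frename r p) (scons b (scons a (scons w (nth w [:: gx; gy])))) <-> m = z n.
  move=> an bm; rewrite sat_frename.
  apply: (pz w (scons m (scons n (fun=> n)))); split=> [||//|[|[|i]] //=];
    exact: veq_sym.
rewrite vmem_vdef; split=> [[n un]|[w /sat_fex[a /sat_fex[b]]]].
  (* The pair belongs to a finite initial segment of the graph of [z], which [X_fin] puts in [X]. *)
  have zn : vmem (vpair (vnat n) (vnat (z n))) X.
    apply: X_tr (X_fin n.+1 z) _; exists (Ordinal (ltnSn n)); exact: veq_refl.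
  have [w zw] := zn; have [a na] := vnat_in n; have [b mb] := vnat_in (z n).
  exists w; last exact: veq_trans un zw.
  apply/sat_fex; exists a; apply/sat_fex; exists b; apply/sat_fand; split.
    by apply/sat_fnat; [apply: veq_sym|exists n; apply: veq_sym].
  apply/sat_fand; split.
    by apply/sat_fnat; [apply: veq_sym|exists (z n); apply: veq_sym].
  apply/sat_fand; split; last by apply/(hP _ n _ (z n)) => //; apply: veq_sym.
  by apply/(sat_fpair X_tr) => /=; apply: veq_trans (veq_sym zw) _; apply: vpair_congr.
move=> /sat_fand[/sat_fnat -/(_ (veq_sym Ex))[n an]].
move=> /sat_fand[/sat_fnat -/(_ (veq_sym Ex))[m bm]].
move=> /sat_fand[/(sat_fpair X_tr) /= wab /(hP _ _ _ _ _ an bm) mz] uw.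
exists n; apply: veq_trans uw _; apply: veq_trans wab _.
by apply: vpair_congr => //; rewrite -mz.
Qed.


Lemma arith_fun_least (Q : nat -> (nat -> nat) -> Prop) :
  arith (fun _ e => Q (e 0) (fun i => e i.+1)) ->
  arith_fun (fun e => least (fun n => Q n e)).
Proof.
move=> aQ.
pose P (f : vdom X) v (e : nat -> nat) :=
  (Q v e /\ forall k, Q k e -> v <= k) \/ ((forall k, ~ Q k e) /\ v = 0).
apply: (@arith_ext (fun f e => P f (e 0) (fun i => e i.+1))) => [f e|].
  by rewrite least_eq.
have aQ' : arith (fun _ e => Q (e 0) (fun i => e i.+2)).
  exact: (@arith_ren _ (fun i => if i is j.+1 then j.+2 else 0) aQ).
apply: arith_or; apply: arith_and => //.
- apply: (@arith_all (fun f k e => Q k (fun i => e i.+1) -> e 0 <= k)).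
  apply: arith_imp => //; apply: arith_le; exact: arith_fun_var.
- apply: (@arith_all (fun f k e => ~ Q k (fun i => e i.+1))).
  exact: arith_not.
- by apply: arith_eq; [exact: arith_fun_var|exact: arith_fun_const].
Qed.

Ltac arith_tac := repeat (cbv beta; lazymatch goal with
  | |- _ = _ \/ _ = _ => by [left|right]
  | |- arith_fun _ => first
    [ simple apply arith_fun_const | simple apply arith_fun_var | simple apply arith_fun_succ
    | simple apply arith_fun_add | simple apply arith_fun_mul | simple apply arith_fun_exp
    | simple apply arith_fun_oracle | simple apply arith_fun_least
    | simple apply arith_fun_iteri ]
  | |- arith _ => first
    [ simple apply arith_and | simple apply arith_or | simple apply arith_eq
    | simple apply arith_le | simple apply arith_not | simple apply arith_ex
    | simple apply arith_all | simple apply arith_imp ]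
  end).

Lemma arith_requirement t u : arith_fun t -> arith_fun u ->
  arith (fun _ e => requirement x y (t e) (u e)).
Proof.
move=> at_ au; apply: (@arith_subst (fun _ v e => requirement x y v (u e))) => //.
apply: (@arith_subst (fun _ v e => requirement x y (e 0) v)).
  exact: arith_fun_ren.
unfold requirement, has_length, codes_pair, digits_approx, nproj.
arith_tac.
Qed.

Lemma arith_fun_shift_code : arith_fun (fun e => shift_code (requirement x y) (e 0)).
Proof.
apply: (@arith_ext (fun _ e => is_shift_code (requirement x y) (e 1) (e 0))).
  by move=> f e; rewrite shift_codeE.
unfold is_shift_code, branch, node, extends, has_length.
arith_tac.
all: by apply: arith_requirement; apply: arith_fun_var.
Qed.

End Arithmetical.

(** * Binary expansions *)

Section Reals.
Context (R : realType).

(** The recursion on [B] covers both the truncations of the reals y_m and the nodes of the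
    branch. *)
Lemma binary_partial_sum (B d : nat -> nat) (k : nat) :
  (forall i, B i.+1 = 2 * B i + d i)%N ->
  (B 0%N)%:R + \sum_(i < k) (d i)%:R / 2 ^+ i.+1 = (B k)%:R / 2 ^+ k :> R.
Proof.
move=> BS; elim: k => [|k IH]; first by rewrite big_ord0 addr0 expr0 divr1.
rewrite big_ord_recr /= addrA IH BS natrD natrM exprS.
have k0 : (2 : R) ^+ k != 0 by rewrite expf_neq0.
by field; rewrite k0.
Qed.

Lemma binary_nondecreasing (B d : nat -> nat) :
  (forall i, B i.+1 = 2 * B i + d i)%N ->
  nondecreasing_seq (fun k => (B k)%:R / 2 ^+ k : R).
Proof.
move=> BS; apply/nondecreasing_seqP => k.
rewrite exprS ler_pdivrMr ?exprn_gt0 // BS.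
have k0 : (2 : R) ^+ k != 0 by rewrite expf_neq0.
have -> : (2 * B k + d k)%:R / (2 * 2 ^+ k) * 2 ^+ k = (B k)%:R + (d k)%:R / 2 :> R.
  by rewrite natrD natrM; field; rewrite k0.
by rewrite lerDl divr_ge0.
Qed.

Lemma binary_nonincreasing (B d : nat -> nat) :
  (forall i, B i.+1 = 2 * B i + d i)%N -> (forall i, (d i < 2)%N) ->
  nonincreasing_seq (fun k => ((B k)%:R + 1) / 2 ^+ k : R).
Proof.
move=> BS d2; apply/nonincreasing_seqP => k.
rewrite exprS ler_pdivlMr ?exprn_gt0 // BS.
have k0 : (2 : R) ^+ k != 0 by rewrite expf_neq0.
have -> : ((2 * B k + d k)%:R + 1) / (2 * 2 ^+ k) * 2 ^+ k =
    (B k)%:R + ((d k)%:R + 1) / 2 :> R.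
  by rewrite natrD natrM; field; rewrite k0.
have : (d k)%:R <= 1 :> R by rewrite (ler_nat _ _ 1) -ltnS d2.
by lra.
Qed.

(** The limit is approached by B_k / 2^k from below and by (B_k + 1) / 2^k from above. The upper
    bound is attained if all later digits are 1. *)
Lemma binary_bounds (B d : nat -> nat) (L : R) (l : nat) :
  (forall i, B i.+1 = 2 * B i + d i)%N -> (forall i, (d i < 2)%N) ->
  (fun k => (B k)%:R / 2 ^+ k : R) @ \oo --> L ->
  (B l)%:R <= L * 2 ^+ l <= (B l)%:R + 1.
Proof.
move=> BS d2 BL; have l0 : (0 : R) < 2 ^+ l by rewrite exprn_gt0.
have <- : limn (fun k => (B k)%:R / 2 ^+ k : R) = L by apply: cvg_lim BL.
have cB : cvgn (fun k => (B k)%:R / 2 ^+ k : R) by apply: cvgP BL.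
apply/andP; split.
  rewrite -ler_pdivrMr //.
  exact: (nondecreasing_cvgn_le (binary_nondecreasing BS) cB l).
rewrite -ler_pdivlMr //; apply: limr_le => //; near=> k.
have lk : (l <= k)%N by near: k; exact: nbhs_infty_ge.
apply: le_trans (binary_nonincreasing BS d2 lk).
by rewrite ler_pM2r ?invr_gt0 ?exprn_gt0 // lerDl.
Unshelve. all: by end_near. Qed.

Lemma binary_cvg (B d : nat -> nat) :
  (forall i, B i.+1 = 2 * B i + d i)%N -> (forall i, (d i < 2)%N) ->
  cvgn (fun k => (B k)%:R / 2 ^+ k : R).
Proof.
move=> BS d2; apply: nondecreasing_is_cvgn; first exact: binary_nondecreasing BS.
exists ((B 0%N)%:R + 1) => _ [k _ <-].
have := binary_nonincreasing BS d2 (leq0n k); rewrite expr0 divr1.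
by apply: le_trans; rewrite ler_pM2r ?invr_gt0 ?exprn_gt0 // lerDl.
Qed.

(** For a negative sign, truncation of the absolute value to D puts the scaled real between -(D + 1)
    and -D, whence q = D + 1. *)
Lemma digits_approxP (y : nat -> nat) m (r : R) l p q : codes_real (nproj y m) r ->
  (nproj y m 0 = 0 /\ p = digits_approx y m l /\ q = 0)%N \/
  (nproj y m 0 = 1 /\ p = 0 /\ q = (digits_approx y m l).+1)%N ->
  p%:R - q%:R <= r * 2 ^+ l <= p%:R - q%:R + 1.
Proof.
move=> [s2 d2 cvr] pq.
have BS i : (digits_approx y m i.+1 = 2 * digits_approx y m i + nproj y m i.+2)%N by [].
have := binary_bounds (L := (-1) ^+ nproj y m 0 * r) l BS d2.
have cv : (fun k => (digits_approx y m k)%:R / 2 ^+ k : R) @ \oo -->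
    (-1) ^+ nproj y m 0 * r.
  rewrite (_ : (fun k => _) = (fun k => (-1) ^+ nproj y m 0 * ((-1) ^+ nproj y m 0 *
    ((nproj y m 1)%:R + \sum_(i < k) (nproj y m i.+2)%:R / 2 ^+ i.+1)) : R)).
    by apply: cvgM cvr; exact: cvg_cst.
  by apply/funext => k; rewrite signrMK -(binary_partial_sum k BS).
move=> /(_ cv).
case: pq => -[-> [-> ->]]; first by rewrite expr0 mul1r subr0.
by rewrite expr1 -natr1; lra.
Qed.

Lemma digits_approx_exists (y : nat -> nat) m (r : R) l : codes_real (nproj y m) r ->
  exists p q, (nproj y m 0 = 0 /\ p = digits_approx y m l /\ q = 0)%N \/
    (nproj y m 0 = 1 /\ p = 0 /\ q = (digits_approx y m l).+1)%N.
Proof.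
move=> []; case: (nproj y m 0) => [|[|//]] _ _ _.
  by exists (digits_approx y m l), 0%N; left.
by exists 0%N, (digits_approx y m l).+1; right.
Qed.

Lemma mem_rat_interval k i j a b d e (u : R) :
  codes_pair k i j -> codes_pair i a b -> codes_pair j d e ->
  rat_interval k u = ((a%:R - b%:R) / d.+1%:R < u < (a%:R - b%:R + e.+1%:R) / d.+1%:R).
Proof.
by move=> /codes_pairP kE /codes_pairP iE /codes_pairP jE;
   rewrite /rat_interval kE iE jE.
Qed.

(** * The requirements read as conditions on reals: soundness and density *)

Context (x y : nat -> nat) (ys : nat -> R) (G : nat -> set R).
Hypotheses (y_codes : codes_seq y ys) (x_codes : forall n, codes_open (nproj x n) (G n))
  (G_rat : forall n, range (@ratr R) `<=` G n).

(** At scale 2^l the real y_m is known up to one unit and so is c; the sum lies between w + p - q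
    and w + p - q + 2, which the two inequalities place inside the rational interval. *)
Lemma requirement_sound s n m w l (c : R) : codes_pair s n m ->
  requirement x y s w -> has_length l w ->
  w%:R <= c * 2 ^+ l <= w%:R + 1 -> G n (ys m + c).
Proof.
move=> snm [n' [m' [snm' [l' [k [lw [xk [i [j [kij [a [b [iab [d [e [jde
  [p [q [pq [lo hi]]]]]]]]]]]]]]]]]]]] lw' cw.
move: snm' xk pq => /codes_pairP; rewrite (codes_pairP s n m).1 // => -[<- <-] xk pq.
have ll' := has_length_inj lw' lw; subst l'.
rewrite (x_codes n).2; exists k => //; rewrite (mem_rat_interval _ kij iab jde).
have := digits_approxP (y_codes m) pq; set D := d.+1%:R.
have D0 : 0 < D :> R by rewrite ltr0n.
have P0 : (0 : R) < 2 ^+ l by rewrite exprn_gt0.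
rewrite -(ltr_nat R) !(natrD, natrM, natrX) -/D in lo.
rewrite -(ltr_nat R) !(natrD, natrM, natrX) -/D in hi.
set P := 2 ^+ l in P0 lo hi cw * => /andP[yl yu]; move: cw => /andP[wl wu].
have l' : D * (w%:R + (p%:R - q%:R)) <= D * ((ys m + c) * P).
  by rewrite ler_pM2l // mulrDl; lra.
have u' : D * ((ys m + c) * P) <= D * (w%:R + (p%:R - q%:R) + 2).
  by rewrite ler_pM2l // mulrDl; lra.
rewrite ltr_pdivrMr // ltr_pdivlMr //; apply/andP; split; rewrite -(ltr_pM2r P0).
  by lra.
by lra.
Qed.

(** The interval of [v] translated by y_m contains a rational, which lies in G_n. A fine enough
    binary truncation of this rational minus y_m is the required extension. *)
Lemma requirement_dense s l v : has_length l v ->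
  exists w, (v < w)%N /\ extends v w /\ requirement x y s w.
Proof.
move=> lv; case sE: (unpair s) => [n m]; have snm := (codes_pairP s n m).2 sE.
have P0 : (0 : R) < 2 ^+ l by rewrite exprn_gt0.
have [q0] : exists q : rat, ratr q \in `]v%:R / 2 ^+ l + ys m, v.+1%:R / 2 ^+ l + ys m[.
  by apply: rat_in_itvoo; rewrite ltrD2r ltr_pM2r ?invr_gt0 // ltr_nat.
rewrite in_itv /=; set r : R := ratr q0 => /andP[rl ru].
rewrite -ltrBrDr ltr_pdivrMr // in rl; rewrite -ltrBlDr ltr_pdivlMr // in ru.
have : G n r by apply: G_rat; exists q0.
rewrite (x_codes n).2 => -[k xk].
case kE: (unpair k) => [i j]; have kij := (codes_pairP k i j).2 kE.
case iE: (unpair i) => [a b]; have iab := (codes_pairP i a b).2 iE.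
case jE: (unpair j) => [d e]; have jde := (codes_pairP j d e).2 jE.
rewrite (mem_rat_interval _ kij iab jde); set D := d.+1%:R.
have D0 : 0 < D :> R by rewrite ltr0n.
rewrite ltr_pdivrMr // ltr_pdivlMr // => /andP[lo hi].
(* At a scale [g] this small, two units of rounding on each side still fit. *)
have [g [g0 glo ghi]] : exists g, [/\ (0 < g)%N,
    2 * D < (r * D - (a%:R - b%:R)) * 2 ^+ (l + g) &
    2 * D < (a%:R - b%:R + e.+1%:R - r * D) * 2 ^+ (l + g)].
  pose t1 := 2 * D / (r * D - (a%:R - b%:R)).
  pose t2 := 2 * D / (a%:R - b%:R + e.+1%:R - r * D).
  (* 2^n exceeds [t] once n is at least [Num.bound t]; the sum serves both ratios, and the successor
     makes [g] positive. *)
  exists (Num.bound t1 + Num.bound t2).+1; split => //.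
    rewrite [ltRHS]mulrC -ltr_pdivrMr ?subr_gt0 //; apply: (@upper_nthrootP _ t1).
    by apply: leq_trans (leq_addl _ _); apply: leqW; exact: leq_addr.
  rewrite [ltRHS]mulrC -ltr_pdivrMr ?subr_gt0 //; apply: (@upper_nthrootP _ t2).
  by apply: leq_trans (leq_addl _ _); apply: leqW; exact: leq_addl.
have g1 : (0 : R) < 2 ^+ g by rewrite exprn_gt0.
have PE : (2 : R) ^+ (l + g) = 2 ^+ l * 2 ^+ g by rewrite exprD.
set u := (r - ys m) * 2 ^+ (l + g).
have vu : (v * 2 ^ g)%:R < u by rewrite natrM natrX /u PE mulrA ltr_pM2r.
have uv : u < (v.+1 * 2 ^ g)%:R by rewrite natrM natrX /u PE mulrA ltr_pM2r.
have u0 : 0 <= u by apply: le_trans (ltW vu).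
have /andP[wu uw] := trunc_itv u0; set w := Num.trunc u in wu uw.
have vw : (v * 2 ^ g <= w)%N by rewrite -ltnS -(ltr_nat R) (lt_trans vu).
have wv : (w < v.+1 * 2 ^ g)%N by rewrite -(ltr_nat R) (le_lt_trans wu).
exists w; split.
  (* A string is a positive number and [g] is positive, so v < v 2^g <= w. *)
  have v0 : (0 < v)%N by case: lv => + _; apply: leq_trans; rewrite expn_gt0.
  by apply: leq_trans vw; rewrite -{1}(muln1 v) ltn_pmul2l // -{1}(expn0 2) ltn_exp2l.
split; first by exists g.
exists n, m; split => //; exists (l + g)%N, k; split.
  exact: has_length_mul lv vw wv.
split; first exact: xk.
exists i, j; split => //; exists a, b; split => //; exists d, e; split => //.
have [p [q pq]] := digits_approx_exists (l + g) (y_codes m).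
exists p, q; split => //; have := digits_approxP (y_codes m) pq.
rewrite -!(ltr_nat R) !(natrD, natrM, natrX) -/D.
move: wu uw glo ghi; rewrite /u -natr1; set P := 2 ^+ (l + g).
move=> wu uw glo ghi /andP[yl yu].
(* Rounding down to [w] loses less than one unit and to p - q at most one, so the total error is
   below 2. *)
have l' : D * (r * P - 2) < D * (w%:R + (p%:R - q%:R)) by rewrite ltr_pM2l //; lra.
have u' : D * (w%:R + (p%:R - q%:R) + 2) <= D * (r * P + 2) by rewrite ler_pM2l //; lra.
by split; lra.
Qed.

End Reals.

(** * The shift and its code in L_(alpha+omega) *)

Unset Implicit Arguments.

Theorem mainTheorem7 (R : realType) (alpha : vset) (y x : nat -> nat)
    (ys : nat -> R) (G : nat -> set R) (T : set R)
    (alpha_ord : is_ordinal alpha)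
    (yL : in_L alpha y) (y_codes : codes_seq y ys)
    (ys_cvg : ys @ \oo --> ys 0%N)
    (xL : in_L alpha x) (x_codes : forall n, codes_open (nproj x n) (G n))
    (G_fam : forall n, code_family alpha (G n))
    (T_def : T = \bigcap_n G n) :
  exists (c : R) (M : int),
    let h := fun u : R => u + c in
    [/\ T (h (ys 0%N)),
        forall m : nat, (M < m%:Z)%R -> T (h (ys m)) &
        exists2 z, in_L (vadd alpha vomega) z & codes_real z c].
Proof.
have G_rat n : range (@ratr R) `<=` G n by have [] := G_fam n.
have dense := requirement_dense y_codes x_codes G_rat.
pose B := branch (requirement x y); pose d k : nat := odd (B k.+1).
have BS k : B k.+1 = (2 * B k + d k)%N by exact: branchS dense k.
have d2 k : (d k < 2)%N by rewrite ltnS leq_b1.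
have Bc := @binary_cvg R _ _ BS d2.
set c := limn (fun k => (B k)%:R / 2 ^+ k : R) in Bc *.
have Tc m : T (ys m + c).
  rewrite T_def => n _; have [s snm] := codes_pair_exists n m.
  have [l lB sB] := branch_meets dense s.
  exact: (requirement_sound y_codes x_codes snm sB lB (binary_bounds l BS d2 Bc)).
(* All the translates y_m + c are in [T], so M = 0 will do. *)
exists c, 0; split=> //; exists (shift_code (requirement x y)); last first.
  split=> [//|i|]; first exact: d2.
  (* The sign is positive, and the integer part 1 is the leading 1 of the branch, [B 0]. *)
  rewrite (_ : (fun k => _) = (fun k => (B k)%:R / 2 ^+ k : R)) //.
  apply/funext => k; rewrite -(binary_partial_sum R k BS) expr0 mul1r.
  by rewrite /B (branch0 dense).
pose X n := Lset (vadd alpha (vnat n)).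
have XS n : forall u, vmem u (X n) -> vmem u (X n.+1).
  by move=> u un; apply/Lset_addS; left.
have X0 u : vmem u (Lset alpha) -> vmem u (X 0%N).
  by move=> ua; apply/vmem_Lset_vadd; left.
have X3 u : vmem u (Lset alpha) -> vmem u (X 3) by move=> /X0/XS/XS/XS.
have X_tr n : vtransitive (X n) := @Lset_add_trans _ n alpha_ord.
have nX n : vmem (vnat n) (X 0%N).
  have nx : vmem (vpair (vnat n) (vnat (x n))) (vgraph x) by apply/vmem_vgraph.
  exact: (vpair_trans (X_tr 0%N) (X0 _ xL) nx).1.
(* Each unordered pairing costs one level: ordered pairs of numbers are in L_(alpha+2), and finite
   functions one level higher. *)
have pairX n a b : vmem a (X n) -> vmem b (X n) -> vmem (vupair a b) (X n.+1).
  move=> an bn; have FX i : vmem (if i is 0%N then a else b) (X n) by case: i.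
  apply: vmem_eql (Lset_finite 2 FX); apply/veqP => u; rewrite vmem_upair.
  split=> [[[[|[|i]] i2] /= ui]|[ui|ui]]; [by left|by right|by []| |].
    by exists ord0.
  by exists ord_max.
have opairX a b : vmem (vpair (vnat a) (vnat b)) (X 2).
  by apply: (pairX 1%N); apply: (pairX 0%N).
have X_fin n (v : nat -> nat) :
    vmem (vsup (fun i : 'I_n => vpair (vnat i) (vnat (v i)))) (X 3).
  exact: (Lset_finite n (fun i => opairX i (v i))).
(* The witness is the element 3 of omega: it suffices to define the graph over L_(alpha+3). *)
apply/vmem_Lset_vadd; right; exists 3%N.
apply: (arith_vDef (X_tr 3) (X3 _ xL) (X3 _ yL) X_fin).
exact: (arith_fun_shift_code y (X_tr 3) (X3 _ xL) X_fin).
Qed.
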